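(* Let $\lambda\in(-\frac12,\infty)\setminus\{0\}$, let $p,m,n\in\mathbb{N}_0$ with $p\le m\le n$, and let $l\in\{0,\ldots,p+m+n\}$ be such that $p+m+n-l\pm1$ is even. Put $k_\pm:=\frac12(p+m+n-l\pm1)$ and write $\mathsf{F}_{k,p,m,n}=\mathsf{F}^\lambda_{k,p,m,n}$. Then the following six relations hold: $$(m+\lambda)(p+1)\mathsf{F}_{k_+,p+1,m,n}+(p+2\lambda-1)(m+\lambda)\mathsf{F}_{k_-,p-1,m,n}=(p+\lambda)(m+1)\mathsf{F}_{k_+,p,m+1,n}+(p+\lambda)(m+2\lambda-1)\mathsf{F}_{k_-,p,m-1,n},$$ $$(n+\lambda)(p+1)\mathsf{F}_{k_+,p+1,m,n}+(p+2\lambda-1)(n+\lambda)\mathsf{F}_{k_-,p-1,m,n}=(p+\lambda)(n+1)\mathsf{F}_{k_+,p,m,n+1}+(p+\lambda)(n+2\lambda-1)\mathsf{F}_{k_-,p,m,n-1},$$ $$(p+1)\mathsf{F}_{k_+,p+1,m,n}+(p+2\lambda-1)\mathsf{F}_{k_-,p-1,m,n}=\frac{(2\lambda+l)(p+\lambda)}{\lambda+l+1}\mathsf{F}_{k_-,p,m,n}+\frac{l(p+\lambda)}{\lambda+l-1}\mathsf{F}_{k_+,p,m,n},$$ $$(n+\lambda)(m+1)\mathsf{F}_{k_+,p,m+1,n}+(m+2\lambda-1)(n+\lambda)\mathsf{F}_{k_-,p,m-1,n}=(m+\lambda)(n+1)\mathsf{F}_{k_+,p,m,n+1}+(m+\lambda)(n+2\lambda-1)\mathsf{F}_{k_-,p,m,n-1},$$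 $$(m+1)\mathsf{F}_{k_+,p,m+1,n}+(m+2\lambda-1)\mathsf{F}_{k_-,p,m-1,n}=\frac{(2\lambda+l)(m+\lambda)}{\lambda+l+1}\mathsf{F}_{k_-,p,m,n}+\frac{l(m+\lambda)}{\lambda+l-1}\mathsf{F}_{k_+,p,m,n},$$ $$(n+1)\mathsf{F}_{k_+,p,m,n+1}+(n+2\lambda-1)\mathsf{F}_{k_-,p,m,n-1}=\frac{(2\lambda+l)(n+\lambda)}{\lambda+l+1}\mathsf{F}_{k_-,p,m,n}+\frac{l(n+\lambda)}{\lambda+l-1}\mathsf{F}_{k_+,p,m,n}.$$
   Context: $\mathbb{N}_0=\{0,1,2,\ldots\}$; $(z)_0=1$, $(z)_j=z(z+1)\cdots(z+j-1)$; ${}_rF_s\!\left({a_1,\ldots,a_r\atop b_1,\ldots,b_s};x\right)=\sum_{j\ge0}\frac{(a_1)_j\cdots(a_r)_j}{(b_1)_j\cdots(b_s)_j}\frac{x^j}{j!}$, where a series having upper parameters in $\{0,-1,-2,\ldots\}$ is summed only for $0\le j\le J$, with $J$ the smallest nonnegative integer such that $-J$ is an upper parameter. The coefficients $\mathsf{F}^\lambda_{k,p,m,n}$ are those of the linearization $C_p^\lambda C_m^\lambda C_n^\lambda=\sum_k\mathsf{F}^\lambda_{k,p,m,n}C^\lambda_{p+m+n-2k}$ of three Gegenbauer polynomials. Explicitly, for $p\le m\le n$ in $\mathbb{N}_0$, $\mathsf{F}^\lambda_{k,p,m,n}:=\mathsf{D}^\lambda_{k,p,m,n}$ if $0\le k\le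 p-1$ and $\mathsf{F}^\lambda_{k,p,m,n}:=\mathsf{E}^\lambda_{k,p,m,n}$ if $p\le k\le\lfloor\frac{p+m+n}2\rfloor$, where $$\mathsf{D}_{k,p,m,n}^\lambda=\frac{(m+n)!(\lambda)_m(\lambda)_n(\lambda+m+n+p-2k)(m+n+p-2k)!(\lambda)_k(\lambda)_{p-k}(\lambda)_{m+n-k}(2\lambda)_{m+n+p-k}}{m!\,n!\,(\lambda)_{m+n}(\lambda+m+n+p-k)\,k!\,(p-k)!\,(m+n-k)!\,(\lambda)_{m+n+p-k}(2\lambda)_{m+n+p-2k}}\;{}_{11}F_{10}\!\left({\mathbf a\atop\mathbf b};1\right),$$ $\mathbf a=\big(\lambda,\ \lambda+p-k,\ -k,\ -m,\ -n,\ -m-n+k,\ -\lambda-m-n,\ -\lambda-m-n-p+k,\ \frac{-\lambda+2-m-n}2,\ \frac{-2\lambda+1-m-n}2,\ \frac{-2\lambda+2-m-n}2\big)$, $\mathbf b=\big(1+p-k,\ -\lambda+1-k,\ -\lambda+1-m,\ -\lambda+1-n,\ -\lambda+1-m-n+k,\ -2\lambda+1-m-n,\ -2\lambda+1-m-n-p+k,\ \frac{-\lambda-m-n}2,\ \frac{-m-n}2,\ \frac{1-m-n}2\big)$; $$\mathsf{E}_{k,p,m,n}^\lambda=\frac{(\lambda+m+n+p-2k)(m+n+2p-2k)!(\lambda)_p(\lambda)_{k-p}(\lambda)_{m+p-k}(\lambda)_{n+p-k}(\lambda)_{m+n+p-2k}(2\lambda)_{m+n+p-k}}{(\lambda+m+n+p-k)\,p!\,(k-p)!\,(m+p-k)!\,(n+p-k)!\,(\lambda)_{m+n+p-k}(\lambda)_{m+n+2p-2k}(2\lambda)_{m+n+p-2k}}\;{}_{11}F_{10}\!\left({\mathbf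 c\atop\mathbf d};1\right),$$ $\mathbf c=\big(\lambda,\ \lambda+k-p,\ -p,\ -m-p+k,\ -n-p+k,\ -m-n-p+2k,\ -\lambda-m-n-p+k,\ -\lambda-m-n-2p+2k,\ \frac{-\lambda+2k-2p-m-n+2}2,\ \frac{-2\lambda+1+2k-2p-m-n}2,\ \frac{-2\lambda+2+2k-2p-m-n}2\big)$, $\mathbf d=\big(1+k-p,\ -\lambda+1-p,\ -\lambda+1-m-p+k,\ -\lambda+1-n-p+k,\ -\lambda+1-m-n-p+2k,\ -2\lambda+1-m-n-p+k,\ -2\lambda+1-m-n-2p+2k,\ \frac{-\lambda+2k-2p-m-n}2,\ \frac{2k-2p-m-n}2,\ \frac{1+2k-2p-m-n}2\big)$. Conventions: $\mathsf{E}^\lambda_{k,p,m,n}=0$ if $k>m+p$ (reciprocal factorial of a negative integer is $0$). If the degrees $p,m,n$ are not in increasing order, $\mathsf F^\lambda_{k,p,m,n}$ means the same quantity with the three degrees rearranged in increasing order. $\mathsf{F}^\lambda_{k,p,m,n}=0$ if one of the degrees equals $-1$, or if $k<0$ or $k>\lfloor\frac{p+m+n}2\rfloor$. A term with factor $\frac{l}{\lambda+l-1}$ is read as $0$ when $l=0$. *)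

(* Defs.v *)
From HB Require Import structures.
From mathcomp Require Import all_boot all_order all_algebra.
From mathcomp Require Import all_classical all_reals all_analysis.

Set Implicit Arguments.
Unset Strict Implicit.
Unset Printing Implicit Defensive.

Import Order.TTheory GRing.Theory Num.Theory.
Import numFieldNormedType.Exports.

Local Open Scope ring_scope.

Definition poch (R : realType) (z : R) (j : nat) : R :=
  \prod_(i < j) (z + i%:R).

Definition hyp_term (R : realType) (a b : seq R) (x : R) (j : nat) : R :=
  (\prod_(c <- a) poch c j) / (\prod_(c <- b) poch c j) * (x ^+ j / j`!%:R).

(* The natural numbers J such that - J is an upper parameter. *)
Definition hyp_stops (R : realType) (a : seq R) : seq nat :=
  [seq Num.truncn (- c) | c <- a & - c \is a Num.nat].

(* A terminating series is cut at the smallest J, so that lower parameters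
   which are nonpositive integers do no harm beyond the cut. *)
Definition hyp (R : realType) (a b : seq R) (x : R) : R :=
  if hyp_stops a is J :: s
  then \sum_(0 <= j < (foldr minn J s).+1) hyp_term a b x j
  else limn (series (hyp_term a b x)).

Definition gegDa (R : realType) (lam k p m n : R) : seq R :=
  [:: lam; lam + p - k; - k; - m; - n; - m - n + k; - lam - m - n;
      - lam - m - n - p + k; (- lam + 2 - m - n) / 2;
      (- 2 * lam + 1 - m - n) / 2; (- 2 * lam + 2 - m - n) / 2].

Definition gegDb (R : realType) (lam k p m n : R) : seq R :=
  [:: 1 + p - k; - lam + 1 - k; - lam + 1 - m; - lam + 1 - n;
      - lam + 1 - m - n + k; - 2 * lam + 1 - m - n;
      - 2 * lam + 1 - m - n - p + k; (- lam - m - n) / 2;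
      (- m - n) / 2; (1 - m - n) / 2].

Definition gegEc (R : realType) (lam k p m n : R) : seq R :=
  [:: lam; lam + k - p; - p; - m - p + k; - n - p + k; - m - n - p + 2 * k;
      - lam - m - n - p + k; - lam - m - n - 2 * p + 2 * k;
      (- lam + 2 * k - 2 * p - m - n + 2) / 2;
      (- 2 * lam + 1 + 2 * k - 2 * p - m - n) / 2;
      (- 2 * lam + 2 + 2 * k - 2 * p - m - n) / 2].

Definition gegEd (R : realType) (lam k p m n : R) : seq R :=
  [:: 1 + k - p; - lam + 1 - p; - lam + 1 - m - p + k; - lam + 1 - n - p + k;
      - lam + 1 - m - n - p + 2 * k; - 2 * lam + 1 - m - n - p + k;
      - 2 * lam + 1 - m - n - 2 * p + 2 * k;
      (- lam + 2 * k - 2 * p - m - n) / 2; (2 * k - 2 * p - m - n) / 2;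
      (1 + 2 * k - 2 * p - m - n) / 2].

(* Meant for k < p <= m <= n, where every subtraction in nat is exact. *)
Definition gegD (R : realType) (lam : R) (k p m n : nat) : R :=
  ((m + n)`!%:R * poch lam m * poch lam n
   * (lam + m%:R + n%:R + p%:R - 2 * k%:R) * (m + n + p - 2 * k)`!%:R
   * poch lam k * poch lam (p - k) * poch lam (m + n - k)
   * poch (2 * lam) (m + n + p - k))
  / (m`!%:R * n`!%:R * poch lam (m + n)
     * (lam + m%:R + n%:R + p%:R - k%:R) * k`!%:R * (p - k)`!%:R
     * (m + n - k)`!%:R * poch lam (m + n + p - k)
     * poch (2 * lam) (m + n + p - 2 * k))
  * hyp (gegDa lam k%:R p%:R m%:R n%:R) (gegDb lam k%:R p%:R m%:R n%:R) 1.

(* Meant for p <= m <= n and p <= k <= (p + m + n)./2.  There the only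
   subtraction in nat that can be inexact is m + p - k, and the case m + p < k,
   where 1 / (m + p - k)! is read as 0, is treated separately. *)
Definition gegE (R : realType) (lam : R) (k p m n : nat) : R :=
  if (m + p < k)%N then 0 else
  ((lam + m%:R + n%:R + p%:R - 2 * k%:R) * (m + n + 2 * p - 2 * k)`!%:R
   * poch lam p * poch lam (k - p) * poch lam (m + p - k)
   * poch lam (n + p - k) * poch lam (m + n + p - 2 * k)
   * poch (2 * lam) (m + n + p - k))
  / ((lam + m%:R + n%:R + p%:R - k%:R) * p`!%:R * (k - p)`!%:R
     * (m + p - k)`!%:R * (n + p - k)`!%:R * poch lam (m + n + p - k)
     * poch lam (m + n + 2 * p - 2 * k) * poch (2 * lam) (m + n + p - 2 * k))
  * hyp (gegEc lam k%:R p%:R m%:R n%:R) (gegEd lam k%:R p%:R m%:R n%:R) 1.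

(* The coefficient of C_(p+m+n-2k) in the product C_p C_m C_n of Gegenbauer
   polynomials of parameter lam.  The arguments are integers because the
   degree -1 is allowed, with value 0; the three degrees may come in any
   order. *)
Definition gegF (R : realType) (lam : R) (k p m n : int) : R :=
  if [|| p < 0, m < 0, n < 0, k < 0 | ((p + m + n) %/ 2)%Z < k] then 0
  else if sort leq [:: `|p|%N; `|m|%N; `|n|%N] is [:: p'; m'; n'] then
    if (`|k| < p')%N then gegD lam `|k|%N p' m' n'
    else gegE lam `|k|%N p' m' n'
  else 0.

(* Main.v *)
(* With C_m the Gegenbauer polynomials, Dougall's formula reads
   C_m C_n = sum_l h(l) S(m,n,l) C_l, where S is symmetric in its three degrees
   and vanishes unless they form an even triangle. Multiplication by 2x acts on
   the index of C by the three-term recurrence, hence on S by the same operator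
   [geg_step] in each degree; for S this is a direct computation, so that no
   polynomial is needed. The coefficient of C_l in C_p C_m C_n is h(l) times
   Q(p,m,n,l) = sum_s h(s) S(m,n,s) S(p,s,l). Since [geg_step] is self-adjoint
   for the weight h, it acts on Q in the same way through p, m, n and l, which
   is the content of the six relations. This also forces Q to be symmetric in
   p, m, n. Finally the sum over s is, up to its first term, the 11F10 series
   of D and of E: the substitution (k,p,m,n) -> (p,k,m+p-k,n+p-k) turns the
   parameters of D into those of E, up to their order. *)
Require Import Defs.
From HB Require Import structures.
From mathcomp Require Import all_boot all_order all_algebra.
From mathcomp Require Import all_classical all_reals all_analysis.
From mathcomp Require Import ring lra zify.

Set Implicit Arguments.
Unset Strict Implicit.
Unset Printing Implicit Defensive.

Import Order.TTheory GRing.Theory Num.Theory.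
Import numFieldNormedType.Exports.

Local Open Scope ring_scope.

(** * Pochhammer symbols: reflection and duplication *)

Section Pochhammer.
Variable R : realType.
Implicit Types z : R.

Lemma poch0 z : poch z 0 = 1.
Proof. by rewrite /poch big_ord0. Qed.

Lemma pochS z j : poch z j.+1 = poch z j * (z + j%:R).
Proof. by rewrite /poch big_ord_recr. Qed.

Lemma poch_neq0 z j :
  (forall i, (i < j)%N -> z + i%:R != 0) -> poch z j != 0.
Proof. by move=> zP; apply/prodf_neq0 => i _; apply: zP. Qed.

Lemma poch1 j : poch 1 j = j`!%:R :> R.
Proof.
elim: j => [|j IH]; first by rewrite poch0.
by rewrite pochS IH factS natrM -natr1; ring.
Qed.

Lemma poch_shift z i j : poch (z + i%:R) j * poch z i = poch z (i + j).
Proof.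
elim: j => [|j IH]; first by rewrite poch0 addn0 mul1r.
by rewrite addnS !pochS -IH natrD; ring.
Qed.

(** Changing the sign of each factor of [poch (1 - z - N) j] gives the last [j] factors of
    [poch z N], in reverse order. *)
Lemma poch_reflect z N j : (j <= N)%N ->
  poch (1 - z - N%:R) j * poch z (N - j) = (-1) ^+ j * poch z N.
Proof.
elim: j => [|j IH] leN; first by rewrite poch0 subn0 expr0.
have /IH : (j <= N)%N by lia.
have -> : (N - j = (N - j.+1).+1)%N by lia.
rewrite !pochS exprS -mulrA => {}IH.
have E : (N - j.+1)%:R = N%:R - j%:R - 1 :> R.
  by rewrite natrB // -natr1; ring.
rewrite -mulrA -[in RHS]IH E; ring.
Qed.

Lemma poch_reflect_div x z N j : (j <= N)%N -> x = 1 - z - N%:R ->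
    poch z (N - j) != 0 ->
  poch x j = (-1) ^+ j * poch z N / poch z (N - j).
Proof. by move=> jN -> z0; rewrite -poch_reflect // mulfK. Qed.

Lemma poch_duplicate z j :
  poch (z / 2) j * poch ((z + 1) / 2) j * 4 ^+ j = poch z (2 * j).
Proof.
elim: j => [|j IH]; first by rewrite !poch0 !mul1r.
have -> : (2 * j.+1 = (2 * j).+2)%N by lia.
by rewrite !pochS -IH exprS; field.
Qed.

Lemma poch_reflect_half x z N j : (2 * j <= N)%N -> x = 1 - z - N%:R ->
    poch z (N - 2 * j) != 0 ->
  poch (x / 2) j * poch ((x + 1) / 2) j
    = poch z N / poch z (N - 2 * j) / 4 ^+ j.
Proof.
move=> jN xE z0; apply: (canRL (mulfK _)).
  by rewrite expf_neq0 ?pnatr_eq0.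
by rewrite poch_duplicate (poch_reflect_div jN xE) // exprM sqrrN !expr1n mul1r.
Qed.

Lemma poch_succ_ratio z j : poch (z + 1) j * z = poch z j * (z + j%:R).
Proof.
by rewrite -pochS -[z in _ * z]addr0 -(poch_shift z 1 j) pochS poch0 mul1r.
Qed.

End Pochhammer.

(** * Terminating hypergeometric series *)

Section Hypergeometric.
Variable R : realType.
Implicit Types (a b : seq R) (x : R).

Lemma mem_hyp_stops a t : (t \in hyp_stops a) = (- t%:R \in a).
Proof.
apply/mapP/idP => [[c]|ta]; last first.
  by exists (- t%:R); rewrite ?mem_filter opprK ?natrK ?natr_nat.
by rewrite mem_filter => /andP[/truncnK cE ca] ->; rewrite cE opprK.
Qed.

(** Characterizes the cut by minimality, so that the list of stops, which depends on the arithmetic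
    of [lam], is never computed. *)
Lemma hyp_terminating a b x J : - J%:R \in a ->
    (forall t, - t%:R \in a -> (J <= t)%N) ->
  hyp a b x = \sum_(j < J.+1) hyp_term a b x j.
Proof.
rewrite -mem_hyp_stops => Ja Jmin.
have {}Jmin t : t \in hyp_stops a -> (J <= t)%N.
  by rewrite mem_hyp_stops; exact: Jmin.
rewrite /hyp; case: (hyp_stops a) Ja Jmin => // K s Ja Jmin.
rewrite big_mkord; suff -> : foldr minn K s = J by [].
apply/eqP; rewrite eqn_leq; apply/andP; split.
  elim: s Ja {Jmin} => [|u s IH] /=; first by rewrite inE => /eqP ->.
  rewrite !inE orbCA => /orP[/eqP ->|]; first exact: geq_minl.
  by rewrite geq_min => Ja; rewrite IH ?orbT // inE.
elim: s Jmin {Ja} => [|u s IH] Jmin /=; first by apply: Jmin; rewrite inE.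
rewrite leq_min Jmin ?inE ?eqxx ?orbT //= IH // => t.
by rewrite inE => ts; apply: Jmin; rewrite !inE orbCA ts orbT.
Qed.

Lemma perm_hyp_term a a' b b' x j : perm_eq a a' -> perm_eq b b' ->
  hyp_term a b x j = hyp_term a' b' x j.
Proof.
by move=> aa' bb'; rewrite /hyp_term (perm_big _ aa') (perm_big _ bb').
Qed.

End Hypergeometric.

(** * The weight [h], the kernel [S] and the three-term operator *)

Section Linearization.
Variable R : realType.
Variable lam : R.
Hypothesis lam_gt : - (1 / 2) < lam.
Hypothesis lam_neq0 : lam != 0.

(** For [i >= 1] the lower bound on [lam] makes [lam + i], and likewise [2 * lam + i], positive;
    hence no Pochhammer symbol of [lam] or [2 * lam] vanishes. *)
Let lam_nat i : lam + i%:R != 0.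
Proof.
case: i => [|i]; first by rewrite addr0.
have : 0 <= i%:R :> R by [].
have := lam_gt; rewrite -(@natr1 _ i) => ? ?; apply/lt0r_neq0; lra.
Qed.

Let lam2_nat i : 2 * lam + i%:R != 0.
Proof.
case: i => [|i]; first by rewrite addr0 mulf_neq0.
have : 0 <= i%:R :> R by [].
have := lam_gt; rewrite -(@natr1 _ i) => ? ?; apply/lt0r_neq0; lra.
Qed.

Let fact_neq0 i : i`!%:R != 0 :> R.
Proof. by rewrite pnatr_eq0 -lt0n fact_gt0. Qed.

Let poch_lam i : poch lam i != 0.
Proof. by apply: poch_neq0 => ? _. Qed.

Let poch_2lam i : poch (2 * lam) i != 0.
Proof. by apply: poch_neq0 => ? _. Qed.

Definition geg_a (j : nat) : R := poch lam j / j`!%:R.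
Definition geg_g (N : nat) : R := poch (2 * lam) N / poch lam N.+1.
(** Up to a factor independent of [l], the reciprocal of the squared norm of [C_l] for the
    Gegenbauer weight. *)
Definition geg_h (l : nat) : R := (lam + l%:R) * l`!%:R / poch (2 * lam) l.

(* With m = u + v, n = u + w and l = v + w, this is a_u a_v a_w g_(u+v+w). *)
Definition geg_S (m n l : nat) : R :=
  if [&& ~~ odd (m + n + l), m <= n + l, n <= m + l & l <= m + n]%N then
    geg_a (m + n - l)./2 * geg_a (m + l - n)./2 * geg_a (n + l - m)./2
    * geg_g (m + n + l)./2
  else 0.

(** Read off from [2 (m + lam) x C_m = (m + 1) C_(m+1) + (m + 2 lam - 1) C_(m-1)]; the value 0 at
    [m = 0] encodes [C_(-1) = 0]. *)
Definition geg_step (f : nat -> R) (m : nat) : R :=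
  ((m%:R + 1) * f m.+1
   + (m%:R + 2 * lam - 1) * (if m is m'.+1 then f m' else 0)) / (m%:R + lam).

Lemma geg_aS j : geg_a j.+1 = geg_a j * (lam + j%:R) / (j%:R + 1).
Proof.
have := fact_neq0 j; have : j%:R + 1 != 0 :> R by rewrite natr1 pnatr_eq0.
rewrite /geg_a pochS factS natrM -natr1 => ? ?; field; exact/andP.
Qed.

Lemma geg_gS N :
  geg_g N.+1 = geg_g N * (2 * lam + N%:R) / (lam + N%:R + 1).
Proof.
have := lam_nat N.+1; rewrite -(@natr1 _ N) addrA => ?.
rewrite /geg_g (pochS _ N) (pochS lam N.+1) -(@natr1 _ N) addrA.
by have := poch_lam N.+1; move=> ?; field; apply/andP.
Qed.

Lemma geg_SE m n l u v w : m = (u + v)%N -> n = (u + w)%N -> l = (v + w)%N ->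
  geg_S m n l = geg_a u * geg_a v * geg_a w * geg_g (u + v + w).
Proof.
move=> -> -> ->; rewrite /geg_S ifT; last by lia.
congr (geg_a _ * geg_a _ * geg_a _ * geg_g _); lia.
Qed.

Lemma geg_S0 m n l :
  (forall u v w, m = u + v -> n = u + w -> l <> v + w)%N -> geg_S m n l = 0.
Proof.
move=> H; rewrite /geg_S ifF //; apply/negP => /and4P[? ? ? ?].
by apply: (H (m + n - l)./2 (m + l - n)./2 (n + l - m)./2); lia.
Qed.

Lemma geg_SC12 m n l : geg_S m n l = geg_S n m l.
Proof.
rewrite /geg_S (addnC n m); case: ifP => H; [rewrite ifT|rewrite ifF //]; try lia.
by rewrite [X in X * _]mulrAC.
Qed.

Lemma geg_SC23 m n l : geg_S m n l = geg_S m l n.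
Proof.
rewrite /geg_S; have -> : (m + n + l = m + l + n)%N by lia.
rewrite (addnC l n); case: ifP => H; [rewrite ifT|rewrite ifF //]; try lia.
by rewrite [geg_a (m + n - l)./2 * _]mulrC.
Qed.

Lemma geg_a0 : geg_a 0 = 1.
Proof. by rewrite /geg_a poch0 divr1. Qed.

(** Inside the triangle the four neighbours are unit shifts of [(u, v, w)], so [geg_aS] and [geg_gS]
    reduce the claim to a rational identity. When one degree exceeds the sum of the other two by 1,
    exactly one neighbour survives on each side. *)
Lemma geg_step_S m n l :
  geg_step (fun m => geg_S m n l) m = geg_step (geg_S m n) l.
Proof.
have NE i : i%:R + 1 != 0 :> R by rewrite natr1 pnatr_eq0.
have LE i : i%:R + lam != 0 by rewrite addrC.
have LE1 i : lam + i%:R + 1 != 0 by rewrite -addrA natr1.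
case: (boolP (m == n + l + 1)%N) => [/eqP -> | nB].
  rewrite /geg_step addn1.
  rewrite (@geg_S0 _.+2 n l); last by lia.
  rewrite (@geg_SE _ n l n l 0) //; try lia.
  rewrite (@geg_SE _ n l.+1 n l.+1 0) //; try lia.
  have -> : (if l is l'.+1 then geg_S (n + l).+1 n l' else 0) = 0.
    by case: (l) => [|l'] //; rewrite geg_S0 //; lia.
  rewrite geg_a0 !addn0 addnS geg_aS geg_gS.
  have := LE (n + l).+1; have := LE1 (n + l)%N.
  rewrite -(@natr1 _ (n + l)) natrD => ? ?.
  have := NE l; have := LE l => ? ?; field.
  by do ?[apply/andP; split].
case: (boolP (l == m + n + 1)%N) => [/eqP -> | nC].
  rewrite /geg_step addn1.
  rewrite (@geg_S0 _ n (_.+2)); last by lia.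
  rewrite (@geg_SE m.+1 n _ 0 m.+1 n) //; try lia.
  rewrite (@geg_SE m n _ 0 m n) //; try lia.
  have -> : (if m is m'.+1 then geg_S m' n (m + n).+1 else 0) = 0.
    by case: (m) => [|m'] //; rewrite geg_S0 //; lia.
  rewrite geg_a0 !add0n addSn geg_aS geg_gS.
  have := LE (m + n).+1; have := LE1 (m + n)%N.
  rewrite -(@natr1 _ (m + n)) natrD => ? ?.
  have := NE m; have := LE m => ? ?; field.
  by do ?[apply/andP; split].
case: (boolP (n == m + l + 1)%N) => [/eqP -> | nD].
  rewrite /geg_step addn1.
  rewrite (@geg_SE m.+1 _ l m.+1 0 l) //; try lia.
  rewrite (@geg_SE m _ l.+1 m 0 l.+1) //; try lia.
  have -> : (if m is m'.+1 then geg_S m' (m + l).+1 l else 0) = 0.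
    by case: (m) => [|m'] //; rewrite geg_S0 //; lia.
  have -> : (if l is l'.+1 then geg_S m (m + l).+1 l' else 0) = 0.
    by case: (l) => [|l'] //; rewrite geg_S0 //; lia.
  rewrite geg_a0 !addn0 addSn addnS !geg_aS.
  have := NE m; have := LE m; have := NE l; have := LE l => ? ? ? ?; field.
  by do ?[apply/andP; split].
(* An odd perimeter makes the three triangle inequalities strict, so [u], [v], [w] below are natural
   numbers. *)
case: (boolP [&& odd (m + n + l), m <= n + l, n <= m + l & l <= m + n]%N) => [A|nA].
  have [u [v [w [Em En El]]]] : exists u v w,
    [/\ m = (u + v).+1, n = (u + w).+1 & l = (v + w).+1]%N.
    exists ((m + n - l - 1)./2), ((m + l - n - 1)./2), ((n + l - m - 1)./2).
    by split; lia.
  rewrite {A} Em En El.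
  rewrite /geg_step.
  rewrite (@geg_SE _ _ _ u.+1 v.+1 w) //; try lia.
  rewrite (@geg_SE _ _ _ u v w.+1) //; try lia.
  rewrite (@geg_SE _ _ _ u v.+1 w.+1) //; try lia.
  rewrite (@geg_SE _ _ _ u.+1 v w) //; try lia.
  rewrite !addSn !addnS !geg_aS !geg_gS.
  have := LE (u + v).+1; have := LE (v + w).+1; have := LE1 (u + v + w)%N.
  have := LE1 (u + v + w).+1.
  rewrite -(@natr1 _ (u + v + w)) -(@natr1 _ (v + w)) -(@natr1 _ (u + v)).
  rewrite !natrD => ? ? ? ?.
  have := NE u; have := NE v; have := NE w => ? ? ?.
  field.
  by do ?[apply/andP; split].
(* In the remaining cases every neighbour lies outside the support of [S]. *)
have -> : geg_step (fun m => geg_S m n l) m = 0.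
  rewrite /geg_step geg_S0; last by lia.
  by case: m nB nC nD nA => [|m] *; rewrite ?geg_S0 ?mulr0 ?addr0 ?mul0r //; lia.
rewrite /geg_step geg_S0; last by lia.
by case: l nB nC nD nA => [|l] *; rewrite ?geg_S0 ?mulr0 ?addr0 ?mul0r //; lia.
Qed.

Lemma eq_geg_step f f' m : (forall i, f i = f' i) -> geg_step f m = geg_step f' m.
Proof. by move=> ff'; rewrite /geg_step ff'; case: m => // m; rewrite ff'. Qed.

Lemma geg_step_S23 m n l :
  geg_step (fun n => geg_S m n l) n = geg_step (geg_S m n) l.
Proof.
rewrite (eq_geg_step _ (fun i => geg_SC23 m i l)) -geg_step_S.
rewrite (eq_geg_step _ (fun i => geg_SC23 i l n)); exact: geg_step_S.
Qed.

Lemma geg_step_sum N (c : nat -> R) (f : nat -> nat -> R) m :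
  geg_step (fun i => \sum_(s < N) c s * f s i) m =
  \sum_(s < N) c s * geg_step (f s) m.
Proof.
rewrite /geg_step.
have -> : (if m is m'.+1 then \sum_(s < N) c s * f s m' else 0)
          = \sum_(s < N) c s * (if m is m'.+1 then f s m' else 0).
  by case: m => // ; rewrite big1 // => s; rewrite mulr0.
rewrite !mulr_sumr -big_split /= mulr_suml; apply: eq_bigr => s _; ring.
Qed.

(** The coefficient of [f m.+1] in [geg_step f m] is nonzero, so the recurrence can be solved for
    it; this drives the induction for the symmetry of [Q]. *)
Lemma geg_step_inj f f' m : geg_step f m = geg_step f' m ->
  (forall i, (i < m)%N -> f i = f' i) -> f m.+1 = f' m.+1.
Proof.
have lm : m%:R + lam != 0 by rewrite addrC.
have m1 : m%:R + 1 != 0 :> R by rewrite natr1 pnatr_eq0.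
rewrite /geg_step => /(mulIf (invr_neq0 lm)) E ff'.
apply: (mulfI m1); move: E.
by case: m ff' {lm m1} => [_|m ff']; [|rewrite (ff' m) //] => /addIr.
Qed.

(** * The triple sums [Q]: recurrences and symmetry *)

(* Summation by parts: the weight [geg_h] makes [geg_step] formally
   self-adjoint. *)
Lemma geg_step_adjoint (f g : nat -> R) M :
  \sum_(s < M.+1) geg_h s * (f s * geg_step g s - geg_step f s * g s) =
  (M.+1)`!%:R / poch (2 * lam) M * (f M * g M.+1 - f M.+1 * g M).
Proof.
elim: M => [|M IH].
  rewrite big_ord1 /geg_step /geg_h /= poch0 fact0 (factS 0) fact0 mul1n !mulr0 !addr0.
  by field; rewrite lam_neq0.
have L1 : M.+1%:R + lam != 0 by rewrite addrC.
have P1 := poch_2lam M; have P2 := lam2_nat M.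
rewrite big_ord_recr /= IH /geg_step /geg_h pochS (factS M.+1).
move: L1; rewrite natrM -(@natr1 _ M.+1) -(@natr1 _ M) => L1.
by field; do ?[apply/andP; split].
Qed.

Definition geg_Q (p m n l : nat) : R :=
  \sum_(s < (m + n).+1) geg_h s * geg_S m n s * geg_S p s l.

(** [geg_S m n s] vanishes for [s > m + n]. This gives one range of summation for all the degrees
    that [geg_step] touches. *)
Lemma geg_Q_widen N p m n l : (m + n < N)%N ->
  geg_Q p m n l = \sum_(s < N) geg_h s * geg_S m n s * geg_S p s l.
Proof.
move=> mnN; rewrite /geg_Q.
rewrite (big_ord_widen N (fun s => geg_h s * geg_S m n s * geg_S p s l)) //.
rewrite [RHS](bigID (fun s : 'I_N => (s < (m + n).+1)%N)) /=.
rewrite [X in _ = _ + X]big1 ?addr0 // => s ?.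
by rewrite (@geg_S0 m n s) ?mulr0 ?mul0r //; lia.
Qed.

Lemma geg_step_Q1 p m n l :
  geg_step (fun i => geg_Q i m n l) p = geg_step (geg_Q p m n) l.
Proof.
rewrite (geg_step_sum _ (fun s => geg_h s * geg_S m n s)
           (fun s i => geg_S i s l)).
rewrite (geg_step_sum _ (fun s => geg_h s * geg_S m n s)
           (fun s => geg_S p s)).
by apply: eq_bigr => s _; rewrite geg_step_S.
Qed.

(** The operator passes from [m] to [s] inside [S(m,n,s)], then by self-adjointness to [s] inside
    [S(p,s,l)], and from there to [l]. *)
Lemma geg_step_Q2 p m n l :
  geg_step (fun i => geg_Q p i n l) m = geg_step (geg_Q p m n) l.
Proof.
pose N := (m + n).+3.
have -> : geg_step (fun i => geg_Q p i n l) m =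
  geg_step (fun i => \sum_(s < N) geg_h s * geg_S p s l * geg_S i n s) m.
  have E i : (i <= m.+1)%N ->
      geg_Q p i n l = \sum_(s < N) geg_h s * geg_S p s l * geg_S i n s.
    move=> im; rewrite (@geg_Q_widen N); last by rewrite /N; lia.
    by apply: eq_bigr => s _; rewrite mulrAC.
  by rewrite /geg_step E //; case: (m) E => // k E; rewrite E //; lia.
rewrite (@geg_step_sum _ (fun s => geg_h s * geg_S p s l) (fun s i => geg_S i n s)).
rewrite (@eq_geg_step (geg_Q p m n)
   (fun i => \sum_(s < N) geg_h s * geg_S m n s * geg_S p s i)); last first.
  by move=> i; apply: geg_Q_widen; rewrite /N; lia.
rewrite (@geg_step_sum _ (fun s => geg_h s * geg_S m n s) (fun s => geg_S p s)).
apply/eqP; rewrite -subr_eq0 -sumrB.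
(* The cut is beyond the support of [geg_S m n], so the boundary term vanishes. *)
have := @geg_step_adjoint (fun s => geg_S p s l) (geg_S m n) (m + n).+2.
rewrite (@geg_S0 m n (m + n).+2); last by lia.
rewrite (@geg_S0 m n (m + n).+3); last by lia.
rewrite !mulr0 subrr mulr0 => adj.
apply/eqP; rewrite -[RHS]adj; apply: eq_bigr => s _.
rewrite (@geg_step_S m n s) -(@geg_step_S23 p s l).
ring.
Qed.

Lemma geg_QC23 p m n l : geg_Q p m n l = geg_Q p n m l.
Proof.
by rewrite /geg_Q addnC; apply: eq_bigr => s _; rewrite (geg_SC12 m).
Qed.

(** Orthogonality: as [C_0 = 1], [S(0,m,l)] is the normalized inner product of [C_m] and [C_l]. *)
Lemma geg_S_0 m l : geg_S 0 m l = if m == l then (geg_h m)^-1 else 0.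
Proof.
case: eqP => [<-|ml]; last by rewrite geg_S0 //; lia.
rewrite (@geg_SE 0 m m 0 0 m) // !geg_a0 !mul1r !add0n.
rewrite /geg_a /geg_g /geg_h pochS.
have ? := poch_lam m; have ? := poch_2lam m; have ? := lam_nat m.
by have ? := fact_neq0 m; field; do ?[apply/andP; split].
Qed.

Lemma geg_h_neq0 l : geg_h l != 0.
Proof. by rewrite !mulf_neq0 ?invr_neq0. Qed.

Lemma geg_Q01 m n l : geg_Q 0 m n l = geg_S m n l.
Proof.
rewrite (@geg_Q_widen (maxn l (m + n)).+1); last by lia.
have lM : (l < (maxn l (m + n)).+1)%N by lia.
rewrite (bigD1 (Ordinal lM)) //= geg_S_0 eqxx mulrAC mulfV ?geg_h_neq0 // mul1r.
rewrite big1 ?addr0 // => s sl; rewrite geg_S_0 ifF ?mulr0 //.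
exact/negbTE.
Qed.

Lemma geg_Q02 m n l : geg_Q m 0 n l = geg_S m n l.
Proof.
rewrite /geg_Q (bigD1 (Ordinal (leqnn (0 + n).+1))) //= geg_S_0 eqxx add0n.
rewrite mulfV ?geg_h_neq0 // mul1r big1 ?addr0 // => s sn.
by rewrite geg_S_0 ifF ?mulr0 ?mul0r // eq_sym; exact/negbTE.
Qed.

(** Induction on [p]. At [p = 0] both sides collapse to [S(m,n,l)]; afterwards [geg_step] in either
    of the first two degrees is [geg_step] in [l], where the induction hypothesis applies. *)
Lemma geg_QC12 p m n l : geg_Q p m n l = geg_Q m p n l.
Proof.
elim/ltn_ind: p m => -[|p] IH m; first by rewrite geg_Q01 geg_Q02.
apply: (@geg_step_inj (fun i => geg_Q i m n l) (fun i => geg_Q m i n l)).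
  rewrite geg_step_Q1 -geg_step_Q2 (eq_geg_step _ (fun i => IH p (leqnn _) i)).
  by rewrite geg_step_Q1 geg_step_Q2.
by move=> i ip; apply: IH; lia.
Qed.

(** * From the sum over [s] to the series of D and E *)

(* The summand of Q with s = M + N - 2j, for D with (K,P,M,N) = (k,p,m,n) and
   for E with (K,P,M,N) = (p,k,m+p-k,n+p-k). *)
Definition geg_term (K P M N j : nat) : R :=
  geg_a j * geg_a (M - j) * geg_a (N - j) * geg_g (M + N - j)
  * geg_a (K - j) * geg_a (P - K + j) * geg_a (M + N - K - j)
  * geg_g (M + N + (P - K) - j) * geg_h (M + N - 2 * j).

(** Reflection turns each index of the form [N - j] into a parameter, and with duplication
    [M + N - 2j] yields the half-integral pairs. The signs and the powers of 4 cancel between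
    numerator and denominator. *)
Lemma geg_term_hyp K P M N j :
    (K <= P)%N -> (j <= K)%N -> (j <= M)%N -> (j <= N)%N ->
    (K + j <= M + N)%N ->
  geg_term K P M N j = geg_term K P M N 0 *
    hyp_term (gegDa lam K%:R P%:R M%:R N%:R)
      (gegDb lam K%:R P%:R M%:R N%:R) 1 j.
Proof.
move=> KP jK jM jN jMN.
have p1 i : poch 1 i != 0 :> R by rewrite poch1.
have sgn0 : (-1) ^+ j != 0 :> R by rewrite signr_eq0.
rewrite /hyp_term /gegDa /gegDb !big_cons !big_nil !mulr1 expr1n.
have PK : P%:R = (P - K)%:R + K%:R :> R by rewrite -natrD subnK.
have MNK : (M + N - K)%:R = M%:R + N%:R - K%:R :> R by rewrite natrB ?natrD //; lia.
rewrite PK addrA addrK [1 + _]addrA addrK.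
rewrite (@poch_reflect_div _ (- K%:R) 1 K) //; last by ring.
rewrite (@poch_reflect_div _ (- M%:R) 1 M) //; last by ring.
rewrite (@poch_reflect_div _ (- N%:R) 1 N) //; last by ring.
rewrite (@poch_reflect_div _ (- M%:R - N%:R + K%:R) 1 (M + N - K)) //;
  [|lia|rewrite MNK; ring].
rewrite (@poch_reflect_div _ (- lam - M%:R - N%:R) lam (M + N).+1) //;
  [|lia|rewrite -(@natr1 _ (M + N)) natrD; ring].
rewrite (@poch_reflect_div _ (- lam - M%:R - N%:R - _ + _) lam
   (M + N + (P - K)).+1) //;
  [|lia|rewrite -(@natr1 _ (M + N + (P - K))) !natrD; ring].
rewrite (@poch_reflect_div _ (- lam + 1 - K%:R) lam K) //; last by ring.
rewrite (@poch_reflect_div _ (- lam + 1 - M%:R) lam M) //; last by ring.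
rewrite (@poch_reflect_div _ (- lam + 1 - N%:R) lam N) //; last by ring.
rewrite (@poch_reflect_div _ (- lam + 1 - M%:R - _ + _) lam (M + N - K)) //;
  [|lia|rewrite MNK; ring].
rewrite (@poch_reflect_div _ (- 2 * lam + 1 - M%:R - N%:R) (2 * lam) (M + N)) //;
  [|lia|rewrite natrD; ring].
rewrite (@poch_reflect_div _ (- 2 * lam + 1 - M%:R - N%:R - _ + _) (2 * lam)
   (M + N + (P - K))) //; [|lia|rewrite !natrD; ring].
have -> : poch (lam + (P - K)%:R) j = poch lam (P - K + j) / poch lam (P - K).
  by rewrite -poch_shift mulfK.
have -> : poch (1 + (P - K)%:R) j = poch 1 (P - K + j) / poch 1 (P - K) :> R.
  by rewrite -poch_shift mulfK.
have -> : (- 2 * lam + 2 - M%:R - N%:R) / 2 =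
          ((- 2 * lam + 1 - M%:R - N%:R) + 1) / 2 by field.
have -> : (1 - M%:R - N%:R) / 2 = ((- M%:R - N%:R) + 1) / 2 :> R by field.
rewrite (@poch_reflect_half _ _ (2 * lam) (M + N)) //; [|lia|rewrite natrD; ring].
rewrite (@poch_reflect_half _ _ 1 (M + N)) //; [|lia|rewrite natrD; ring].
have MNj : (M + N - 2 * j)%:R = M%:R + N%:R - 2 * j%:R :> R.
  by rewrite natrB; [ring|lia].
pose w := (- lam - M%:R - N%:R) / 2.
have lMN : lam + M%:R + N%:R != 0 by rewrite -addrA -natrD.
have lMNj : lam + M%:R + N%:R - 2 * j%:R != 0.
  by rewrite -2!addrA [M%:R + _]addrA -MNj.
have w0 : poch w j != 0.
  apply: poch_neq0 => i ij.
  have -> : w + i%:R = - (lam + (M + N - 2 * i)%:R) / 2.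
    by rewrite natrB; [rewrite /w; field|lia].
  by rewrite mulf_neq0 ?oppr_eq0 // invr_eq0 pnatr_eq0.
(* The parameters [w + 1] over [w] produce the linear factor [lam + M + N - 2j] of the weight
   [h]. *)
have -> : poch ((- lam + 2 - M%:R - N%:R) / 2) j =
          poch w j * (lam + M%:R + N%:R - 2 * j%:R) / (lam + M%:R + N%:R).
  have -> : (- lam + 2 - M%:R - N%:R) / 2 = w + 1 by rewrite /w; field.
  have wn0 : w != 0 by rewrite /w -!opprD mulf_neq0 ?oppr_eq0 // invr_eq0 pnatr_eq0.
  apply: (mulIf wn0); rewrite poch_succ_ratio /w; field.
  exact: lMN.
rewrite -/w /geg_term /geg_a /geg_g /geg_h ?subn0 ?muln0 ?addn0 ?subn0.
rewrite !poch1 poch0 fact0 MNj natrD.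
have -> : ((M + N).+1 - j = (M + N - j).+1)%N by lia.
have -> : ((M + N + (P - K)).+1 - j = (M + N + (P - K) - j).+1)%N by lia.
have four : (4 : R) ^+ j != 0 by rewrite expf_neq0 ?pnatr_eq0.
field.
by do ?[apply/andP; split].
Qed.

(* The last five upper parameters can be nonpositive integers too, for instance
   when 2 lam is an integer; they never cut the series before J. *)
Lemma geg_stop_lower K P M N t J :
    (K <= P)%N -> (J <= K)%N -> (J <= M)%N -> (J <= N)%N ->
    (K + J <= M + N)%N ->
  - t%:R \in gegDa lam K%:R P%:R M%:R N%:R -> (J <= t)%N.
Proof.
move=> KP JK JM JN JMN; have L := lam_gt.
have t0 : 0 <= t%:R :> R by [].
have PK : P%:R = (P - K)%:R + K%:R :> R by rewrite -natrD subnK.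
have PK0 : 0 <= (P - K)%:R :> R by [].
have below a b : a%:R < b%:R :> R -> (a < b)%N by rewrite ltr_nat.
(* The bounds on [lam] give [M + N <= 2t + 2], and equality would force [lam] to be 0 or
   [- (1 / 2)]. So [2J <= M + N <= 2t + 1]. *)
have half_case : M%:R + N%:R + 2 * lam = 2 * t%:R + 1 \/
    M%:R + N%:R + 2 * lam = 2 * t%:R + 2 \/
    M%:R + N%:R + lam = 2 * t%:R + 2 -> (J <= t)%N.
  move=> E; have lt3 : (M + N < 2 * t + 3)%N.
    apply: below; rewrite (natrD _ M) (natrD _ (2 * t)) (natrM _ 2).
    by case: E => [|[]] E; lra.
  have ne2 : (M + N != 2 * t + 2)%N.
    apply: contra_neq lam_neq0 => /(congr1 (fun i => i%:R : R)).
    rewrite (natrD _ M) (natrD _ (2 * t)) (natrM _ 2); case: E => [|[]] E F; lra.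
  lia.
rewrite /gegDa PK !inE => /or4P[/eqP E|/eqP E|/eqP E|/or4P[/eqP E|/eqP E|/eqP E|
  /or4P[/eqP E|/eqP E|/eqP E|/orP[/eqP E|/eqP E]]]].
- by have /eqP[] := lam_nat t; lra.
- by have /eqP[] := lam_nat (P - K + t); rewrite natrD; lra.
- by suff : (K < t + 1)%N; [lia|apply: below; rewrite natrD; lra].
- by suff : (M < t + 1)%N; [lia|apply: below; rewrite natrD; lra].
- by suff : (N < t + 1)%N; [lia|apply: below; rewrite natrD; lra].
- suff : (M + N < t + K + 1)%N by lia.
  by apply: below; rewrite !natrD; lra.
- suff : (M + N < t + 1)%N by lia.
  by apply: below; rewrite !natrD; lra.
- suff : (M + N + (P - K) < t + 1)%N by lia.
  by apply: below; rewrite !natrD; lra.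
- by apply: half_case; right; right; lra.
- by apply: half_case; left; lra.
- by apply: half_case; right; left; lra.
Qed.

(** Parity and the triangle inequalities confine [s] in [Q] to a progression descending from [L] by
    steps of two; its position [i] becomes the index of the series. *)
Lemma sum_even_gap (f : nat -> R) L N J : (L < N)%N -> (2 * J <= L)%N ->
    (forall s, (forall i, (i <= J)%N -> s <> L - 2 * i)%N -> f s = 0) ->
  \sum_(s < N) f s = \sum_(i < J.+1) f (L - 2 * i)%N.
Proof.
move=> LN JL f0.
have lN (i : 'I_J.+1) : (L - 2 * i < N)%N by lia.
pose phi i := Ordinal (lN i).
have phi_inj : injective phi.
  by move=> i j [] E; apply: val_inj => /=; have := ltn_ord i; have := ltn_ord j; lia.
rewrite (bigID (mem [set phi i | i in [set: 'I_J.+1]])) /=.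
rewrite [X in _ + X]big1 ?addr0 => [|s sn].
  rewrite big_imset /=; last exact: (in2W phi_inj).
  by apply: eq_bigl => i; rewrite inE.
apply: f0 => i iJ E; move/imsetP: sn; apply.
have iJ1 : (i < J.+1)%N by [].
by exists (Ordinal iJ1); rewrite ?inE //; apply: val_inj.
Qed.

(** The hypotheses make [J] the least of [K], [M], [N], [M + N - K], which is where the series
    stops. *)
Lemma hyp_geg K P M N J a b :
    (K <= P)%N -> (J <= K)%N -> (J <= M)%N -> (J <= N)%N ->
    (K + J <= M + N)%N ->
    J%:R \in [:: K%:R; M%:R; N%:R; (M + N - K)%:R : R] ->
    perm_eq a (gegDa lam K%:R P%:R M%:R N%:R) ->
    perm_eq b (gegDb lam K%:R P%:R M%:R N%:R) ->
  geg_term K P M N 0 * hyp a b 1 = \sum_(j < J.+1) geg_term K P M N j.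
Proof.
move=> KP JK JM JN JMN JJ aP bP; rewrite (@hyp_terminating _ a b 1 J).
- rewrite mulr_sumr; apply: eq_bigr => j _; have := ltn_ord j => jJ.
  by rewrite (@geg_term_hyp _ _ _ _ j) ?(perm_hyp_term _ _ aP bP) //; lia.
- rewrite (perm_mem aP) /gegDa !inE; move: JJ; rewrite natrB; last by lia.
  rewrite natrD !inE => /or4P[] /eqP ->; rewrite ?eqxx ?orbT //.
  by rewrite opprB [K%:R - _]addrC opprD eqxx !orbT.
- by move=> t; rewrite (perm_mem aP); exact: geg_stop_lower.
Qed.

(** In [Q], [s] is at most [m + n] and at most [p + l]. For [k < p] the first bound is the smaller,
    and the series starts at [s = m + n]. *)
Lemma gegD_Q k p m n l : (k < p)%N -> (p <= m)%N -> (m <= n)%N ->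
  (p + m + n = 2 * k + l)%N -> gegD lam k p m n = geg_h l * geg_Q p m n l.
Proof.
move=> kp pm mn pmn.
have -> : geg_Q p m n l = \sum_(j < k.+1) geg_term k p m n j.
  (* For [s = m + n - 2j] the binding condition is [l <= p + s], that is [j <= k]. *)
  rewrite /geg_Q (@sum_even_gap (fun s => geg_h s * geg_S m n s * geg_S p s l)
    (m + n) _ k) //; [|lia|].
    apply: eq_bigr => j _; have := ltn_ord j => jk.
    rewrite (@geg_SE m n _ j (m - j) (n - j)); try lia.
    rewrite (@geg_SE p _ l (k - j) (p - k + j) (m + n - k - j)); try lia.
    rewrite /geg_term.
    have -> : (j + (m - j) + (n - j) = m + n - j)%N by lia.
    have -> : (k - j + (p - k + j) + (m + n - k - j) = m + n + (p - k) - j)%N by lia.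
    ring.
  move=> s sP; rewrite /geg_S; case: ifP => H1; rewrite ?mulr0 ?mul0r //.
  case: ifP => H2; rewrite ?mulr0 ?mul0r //.
  by case: (sP ((m + n - s)./2)); lia.
rewrite -(@hyp_geg k p m n k (gegDa lam k%:R p%:R m%:R n%:R)
  (gegDb lam k%:R p%:R m%:R n%:R)) //; try lia; last by rewrite inE eqxx.
rewrite mulrA /gegD; congr (_ * _).
have -> : (m + n + p - 2 * k = l)%N by lia.
have El : lam + m%:R + n%:R + p%:R - 2 * k%:R = lam + l%:R.
  have := congr1 (fun i => i%:R : R) pmn.
  by rewrite (natrD _ (p + m)) (natrD _ p) (natrD _ (2 * k)) (natrM _ 2) => E; lra.
rewrite El /geg_term /geg_a /geg_h /geg_g ?subn0 ?muln0 ?addn0 ?subn0 !pochS poch0.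
have -> : (m + n + p - k = m + n + (p - k))%N by lia.
have En : (m + n + (p - k))%:R = m%:R + n%:R + p%:R - k%:R :> R.
  by rewrite natrD natrB ?natrD; [ring|lia].
rewrite En natrD fact0.
have ? : lam + (m%:R + n%:R + p%:R - k%:R) != 0 by rewrite -En.
have ? : lam + (m%:R + n%:R) != 0 by rewrite -natrD.
field.
by do ?[apply/andP; split].
Qed.

(** For [p <= k] the smaller bound is [p + l], so the series starts at
    [s = p + l = m + n + 2p - 2k]. *)
Lemma gegE_Q k p m n l : (p <= k)%N -> (p <= m)%N -> (m <= n)%N ->
  (p + m + n = 2 * k + l)%N -> gegE lam k p m n = geg_h l * geg_Q p m n l.
Proof.
move=> kp pm mn pmn; rewrite /gegE; case: ltnP => [mpk|kmp].
  (* [n <= m + s] and [s <= p + l] together force [k <= m + p]. *)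
  rewrite /geg_Q big1 ?mulr0 // => s _.
  rewrite /geg_S; case: ifP => H1; rewrite ?mulr0 ?mul0r //.
  by case: ifP => H2; rewrite ?mulr0 ?mul0r //; lia.
(* With [s = p + l - 2j], the three bounds on [j] are [l <= p + s], [n <= m + s] and [p <= s + l],
   in this order. *)
pose J := minn (minn p (m + p - k)) (m + n + p - 2 * k).
have Kl : (m + n + p - 2 * k = l)%N by lia.
rewrite Kl.
have -> : geg_Q p m n l = \sum_(j < J.+1) geg_term p k (m + p - k) (n + p - k) j.
  rewrite /geg_Q (@sum_even_gap (fun s => geg_h s * geg_S m n s * geg_S p s l)
    (m + p - k + (n + p - k)) _ J) //; [|lia|lia|].
    apply: eq_bigr => j _; have := ltn_ord j => jk.
    rewrite (@geg_SE m n _ (k - p + j) (m + p - k - j) (n + p - k - j)); try lia.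
    rewrite (@geg_SE p _ l (p - j) j (l - j)); try lia.
    rewrite /geg_term.
    have -> : (k - p + j + (m + p - k - j) + (n + p - k - j) =
      m + p - k + (n + p - k) + (k - p) - j)%N by lia.
    have -> : (p - j + j + (l - j) = m + p - k + (n + p - k) - j)%N by lia.
    have -> : (m + p - k + (n + p - k) - p - j = l - j)%N by lia.
    ring.
  move=> s sP; rewrite /geg_S; case: ifP => H1; rewrite ?mulr0 ?mul0r //.
  case: ifP => H2; rewrite ?mulr0 ?mul0r //.
  by case: (sP ((m + p - k + (n + p - k) - s)./2)); lia.
have M1 : (m + p - k)%:R = m%:R + p%:R - k%:R :> R by rewrite natrB; [ring|lia].
have N1 : (n + p - k)%:R = n%:R + p%:R - k%:R :> R by rewrite natrB; [ring|lia].
rewrite -(@hyp_geg p k (m + p - k) (n + p - k) J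
  (gegEc lam k%:R p%:R m%:R n%:R) (gegEd lam k%:R p%:R m%:R n%:R)); try lia.
- rewrite mulrA; congr (_ * _).
  have El : lam + m%:R + n%:R + p%:R - 2 * k%:R = lam + l%:R.
    have := congr1 (fun i => i%:R : R) pmn.
    by rewrite (natrD _ (p + m)) (natrD _ p) (natrD _ (2 * k)) (natrM _ 2) => E; lra.
  rewrite El /geg_term /geg_a /geg_h /geg_g ?subn0 ?muln0 ?addn0 ?subn0 !pochS poch0.
  have -> : (m + p - k + (n + p - k) = m + n + 2 * p - 2 * k)%N by lia.
  have -> : (m + n + 2 * p - 2 * k + (k - p) = m + n + p - k)%N by lia.
  have -> : (m + n + 2 * p - 2 * k - p = l)%N by lia.
  have En : (m + n + p - k)%:R = m%:R + n%:R + p%:R - k%:R :> R.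
    by rewrite natrB; [ring|lia].
  have ? := lam_nat (m + n + 2 * p - 2 * k).
  have : lam + (m%:R + n%:R + p%:R - k%:R) != 0 by rewrite -En.
  rewrite En fact0 => ?.
  field.
  by do ?[apply/andP; split].
- rewrite !inE.
  have : (J = p \/ J = m + p - k \/ J = m + p - k + (n + p - k) - p)%N by lia.
  by move=> [|[]] ->; rewrite eqxx ?orbT.
(* Only the seventh and eighth upper parameters are exchanged, and in the lower list the sixth and
   seventh. *)
- rewrite M1 N1 /gegEc /gegDa; apply/permP => q /=.
  rewrite [in RHS](addnCA (q (- lam - (m%:R + p%:R - k%:R) - (n%:R + p%:R - k%:R)))).
  by do 11?[apply: (congr2 addn); first by congr (nat_of_bool (q _)); field].
- rewrite M1 N1 /gegEd /gegDb; apply/permP => q /=.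
  rewrite [in RHS](addnCA (q (- 2 * lam + 1 - (m%:R + p%:R - k%:R) - (n%:R + p%:R - k%:R)))).
  by do 11?[apply: (congr2 addn); first by congr (nat_of_bool (q _)); field].
Qed.

(** * The coefficients [F] in terms of [Q], and their recurrence *)

Lemma gegFC12 (k p m n : int) : gegF lam k p m n = gegF lam k m p n.
Proof.
rewrite /gegF orbCA (addrC p m).
have /(perm_sortP leq_total leq_trans anti_leq) -> // :
  perm_eq [:: `|p|%N; `|m|%N; `|n|%N] [:: `|m|%N; `|p|%N; `|n|%N].
by apply/permP => q /=; rewrite addnCA.
Qed.

Lemma gegFC23 (k p m n : int) : gegF lam k p m n = gegF lam k p n m.
Proof.
rewrite /gegF [(m < 0) || _]orbCA (addrAC p m).
have /(perm_sortP leq_total leq_trans anti_leq) -> // :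
  perm_eq [:: `|p|%N; `|m|%N; `|n|%N] [:: `|p|%N; `|n|%N; `|m|%N].
by apply/permP => q /=; rewrite (addnCA (q `|m|%N)).
Qed.

Lemma gegF_neg (k p m n : int) : p < 0 -> gegF lam k p m n = 0.
Proof. by rewrite /gegF => ->. Qed.

(** [F] and [Q] are both symmetric in the degrees, which reduces the claim to sorted degrees. *)
Lemma gegF_Q (k p m n l : nat) : (p + m + n = 2 * k + l)%N ->
  gegF lam k p m n = geg_h l * geg_Q p m n l.
Proof.
have sorted_case a b c : (a <= b)%N -> (b <= c)%N -> (a + b + c = 2 * k + l)%N ->
    gegF lam k a b c = geg_h l * geg_Q a b c l.
  move=> ab bc abc; rewrite /gegF ifF; last by lia.
  have -> : sort leq [:: `|a|%N; `|b|%N; `|c|%N] = [:: a; b; c].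
    by apply: sorted_sort; rewrite //= ?ab ?bc //; exact: leq_trans.
  by case: ifP => ka; [apply: gegD_Q | apply: gegE_Q] => //; lia.
move=> E; have [pm|mp] := leqP p m; have [mn|nm] := leqP m n;
  have [pn|np] := leqP p n.
- exact: sorted_case.
- by lia.
- by rewrite gegFC23 geg_QC23; apply: sorted_case; lia.
- by rewrite gegFC23 gegFC12 geg_QC23 geg_QC12; apply: sorted_case; lia.
- by rewrite gegFC12 geg_QC12; apply: sorted_case; lia.
- by rewrite gegFC12 gegFC23 geg_QC12 geg_QC23; apply: sorted_case; lia.
- by lia.
- rewrite gegFC12 gegFC23 gegFC12 geg_QC12 geg_QC23 geg_QC12.
  by apply: sorted_case; lia.
Qed.

(** Both sides are [h(l) (p + lam)] times [geg_step] of [Q] in [l]. On the right, [k] goes with the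
    index [l + 1] and [k.+1] with [l - 1], so ratios of consecutive weights appear. *)
Lemma gegF_recurrence (k p m n l : nat) : (p + m + n = 2 * k + l + 1)%N ->
  (p%:R + 1) * gegF lam k.+1 (p%:Z + 1) m n
   + (p%:R + 2 * lam - 1) * gegF lam k (p%:Z - 1) m n
   = (2 * lam + l%:R) * (p%:R + lam) / (lam + l%:R + 1) * gegF lam k p m n
     + l%:R * (p%:R + lam) / (lam + l%:R - 1) * gegF lam k.+1 p m n.
Proof.
move=> E; have lp : p%:R + lam != 0 by rewrite addrC.
have h1 : geg_h l.+1 * (2 * lam + l%:R) / (lam + l%:R + 1) =
    geg_h l * (l%:R + 1) / (l%:R + lam).
  have := lam_nat l.+1; have := lam_nat l; have := lam2_nat l; have := poch_2lam l.
  rewrite /geg_h pochS factS natrM -(@natr1 _ l) addrA (addrC l%:R lam) => ? ? ? ?.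
  by field; do ?[apply/andP; split].
transitivity (geg_h l * (p%:R + lam) * geg_step (geg_Q p m n) l).
  rewrite -geg_step_Q1 /geg_step -mulrA [(_ + lam) * _]mulrC mulfVK //.
  rewrite (_ : p%:Z + 1 = p.+1%:Z); last by lia.
  rewrite (@gegF_Q _ _ _ _ l); last by lia.
  case: p E {lp} => [|p] E.
    by rewrite gegF_neg //; ring.
  rewrite (_ : p.+1%:Z - 1 = p%:Z); last by lia.
  by rewrite (@gegF_Q _ _ _ _ l); [ring|lia].
rewrite (@gegF_Q k p m n l.+1); last by lia.
rewrite /geg_step.
transitivity ((p%:R + lam) * geg_Q p m n l.+1 * (geg_h l * (l%:R + 1) / (l%:R + lam))
  + l%:R * (p%:R + lam) / (lam + l%:R - 1) * gegF lam k.+1 p m n); last first.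
  by rewrite -h1; ring.
(* At [l = 0] the factor [l] kills the last term, even if [lam = 1]; for [l >= 1] its denominator is
   nonzero. *)
case: l E {h1} => [|l] E; first by rewrite !mul0r !mulr0; ring.
rewrite (@gegF_Q k.+1 p m n l); last by lia.
have := lam_nat l.+1; have := lam_nat l; have := lam2_nat l; have := poch_2lam l.
rewrite /geg_h pochS factS natrM -(@natr1 _ l) addrA => ? ? ? ?.
by field; do ?[apply/andP; split]; rewrite // ?addrK // [_ + lam]addrC addrA.
Qed.

End Linearization.

(** * The six relations from three recurrences *)

(* For l = 0 the term with l%:R / (lam + l%:R - 1) is 0, also when lam = 1,
   since division is total. *)
Theorem theorem4p5 (R : realType) (lam : R) (p m n l : nat)
    (hlam : - (1 / 2) < lam) (hlam0 : lam != 0)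
    (hpm : (p <= m)%N) (hmn : (m <= n)%N) (hl : (l <= p + m + n)%N)
    (hevenp : (2 %| p%:Z + m%:Z + n%:Z - l%:Z + 1)%Z)
    (hevenm : (2 %| p%:Z + m%:Z + n%:Z - l%:Z - 1)%Z) :
  let kp : int := ((p%:Z + m%:Z + n%:Z - l%:Z + 1) %/ 2)%Z in
  let km : int := ((p%:Z + m%:Z + n%:Z - l%:Z - 1) %/ 2)%Z in
  let F := gegF lam in
  ((m%:R + lam) * (p%:R + 1) * F kp (p%:Z + 1) m n
   + (p%:R + 2 * lam - 1) * (m%:R + lam) * F km (p%:Z - 1) m n
   = (p%:R + lam) * (m%:R + 1) * F kp p (m%:Z + 1) n
     + (p%:R + lam) * (m%:R + 2 * lam - 1) * F km p (m%:Z - 1) n)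
  /\
  ((n%:R + lam) * (p%:R + 1) * F kp (p%:Z + 1) m n
   + (p%:R + 2 * lam - 1) * (n%:R + lam) * F km (p%:Z - 1) m n
   = (p%:R + lam) * (n%:R + 1) * F kp p m (n%:Z + 1)
     + (p%:R + lam) * (n%:R + 2 * lam - 1) * F km p m (n%:Z - 1))
  /\
  ((p%:R + 1) * F kp (p%:Z + 1) m n
   + (p%:R + 2 * lam - 1) * F km (p%:Z - 1) m n
   = (2 * lam + l%:R) * (p%:R + lam) / (lam + l%:R + 1) * F km p m n
     + l%:R * (p%:R + lam) / (lam + l%:R - 1) * F kp p m n)
  /\
  ((n%:R + lam) * (m%:R + 1) * F kp p (m%:Z + 1) n
   + (m%:R + 2 * lam - 1) * (n%:R + lam) * F km p (m%:Z - 1) n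
   = (m%:R + lam) * (n%:R + 1) * F kp p m (n%:Z + 1)
     + (m%:R + lam) * (n%:R + 2 * lam - 1) * F km p m (n%:Z - 1))
  /\
  ((m%:R + 1) * F kp p (m%:Z + 1) n
   + (m%:R + 2 * lam - 1) * F km p (m%:Z - 1) n
   = (2 * lam + l%:R) * (m%:R + lam) / (lam + l%:R + 1) * F km p m n
     + l%:R * (m%:R + lam) / (lam + l%:R - 1) * F kp p m n)
  /\
  ((n%:R + 1) * F kp p m (n%:Z + 1)
   + (n%:R + 2 * lam - 1) * F km p m (n%:Z - 1)
   = (2 * lam + l%:R) * (n%:R + lam) / (lam + l%:R + 1) * F km p m n
     + l%:R * (n%:R + lam) / (lam + l%:R - 1) * F kp p m n).
Proof.
move=> kp km F.
have [k E] : exists k, (p + m + n = 2 * k + l + 1)%N.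
  (* [p + m + n - l] is odd, hence positive; the witness is [km]. *)
  by exists ((p + m + n - l).-1)./2; lia.
have {}hkp : kp = k.+1 by rewrite /kp; lia.
have {}hkm : km = k by rewrite /km; lia.
rewrite {}/F hkp hkm {kp km hkp hkm}.
(* The recurrences in [p], [m], [n] are the third, fifth and sixth relations. Their right sides are
   [p + lam], [m + lam], [n + lam] times one common quantity, and cross-multiplying gives the other
   three. *)
have Rp := gegF_recurrence hlam hlam0 E.
have Rm : (m%:R + 1) * gegF lam k.+1 p (m%:Z + 1) n
   + (m%:R + 2 * lam - 1) * gegF lam k p (m%:Z - 1) n
   = (2 * lam + l%:R) * (m%:R + lam) / (lam + l%:R + 1) * gegF lam k p m n
     + l%:R * (m%:R + lam) / (lam + l%:R - 1) * gegF lam k.+1 p m n.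
  rewrite !(gegFC12 _ _ p); apply: gegF_recurrence => //; lia.
have Rn : (n%:R + 1) * gegF lam k.+1 p m (n%:Z + 1)
   + (n%:R + 2 * lam - 1) * gegF lam k p m (n%:Z - 1)
   = (2 * lam + l%:R) * (n%:R + lam) / (lam + l%:R + 1) * gegF lam k p m n
     + l%:R * (n%:R + lam) / (lam + l%:R - 1) * gegF lam k.+1 p m n.
  rewrite !(gegFC23 _ _ p m) !(gegFC12 _ _ p); apply: gegF_recurrence => //; lia.
split; [|split; [|split; [|split; [|split]]]] => //.
- transitivity ((m%:R + lam) * ((p%:R + 1) * gegF lam k.+1 (p%:Z + 1) m n
   + (p%:R + 2 * lam - 1) * gegF lam k (p%:Z - 1) m n)); first by ring.
  rewrite Rp; transitivity ((p%:R + lam) * ((m%:R + 1) * gegF lam k.+1 p (m%:Z + 1) n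
   + (m%:R + 2 * lam - 1) * gegF lam k p (m%:Z - 1) n)); last by ring.
  by rewrite Rm; ring.
- transitivity ((n%:R + lam) * ((p%:R + 1) * gegF lam k.+1 (p%:Z + 1) m n
   + (p%:R + 2 * lam - 1) * gegF lam k (p%:Z - 1) m n)); first by ring.
  rewrite Rp; transitivity ((p%:R + lam) * ((n%:R + 1) * gegF lam k.+1 p m (n%:Z + 1)
   + (n%:R + 2 * lam - 1) * gegF lam k p m (n%:Z - 1))); last by ring.
  by rewrite Rn; ring.
- transitivity ((n%:R + lam) * ((m%:R + 1) * gegF lam k.+1 p (m%:Z + 1) n
   + (m%:R + 2 * lam - 1) * gegF lam k p (m%:Z - 1) n)); first by ring.
  rewrite Rm; transitivity ((m%:R + lam) * ((n%:R + 1) * gegF lam k.+1 p m (n%:Z + 1)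
   + (n%:R + 2 * lam - 1) * gegF lam k p m (n%:Z - 1))); last by ring.
  by rewrite Rn; ring.
Qed.
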